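(* Let $\beta\ge 1$ be an integer, let $\rho>0$, let $M\in\mathbb{C}^{n\times n}$ be Hermitian positive semidefinite and $\beta$-banded with spectrum contained in $[0,4\rho]$, and let $\mathcal{A}=I\otimes M+M\otimes I\in\mathbb{C}^{n^2\times n^2}$. Then for every $\tau\in\mathbb{R}$ and all indices $k=(k_1,k_2)$, $t=(t_1,t_2)$, $$(\exp(-\tau\mathcal{A}))_{kt}=(\exp(-\tau M))_{k_1t_1}\,(\exp(-\tau M))_{k_2t_2}.$$ Therefore, for $\tau>0$, $$|(\exp(-\tau\mathcal{A}))_{kt}|\le\Phi(k_1,t_1)\,\Phi(k_2,t_2)$$ for all $k=(k_1,k_2)$ and $t=(t_1,t_2)$ with $\min\{|t_1-k_1|,|t_2-k_2|\}\ge\sqrt{4\rho\tau}\,\beta$.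
   Context: A matrix $M\in\mathbb{C}^{n\times n}$ is $\beta$-banded if $M_{ij}=0$ whenever $|i-j|>\beta$. $I$ is the $n\times n$ identity and $\otimes$ the Kronecker product. Lexicographic ordering is used: a row/column index $k\in\{1,\dots,n^2\}$ of $\mathcal{A}$ corresponds to the pair $k=(k_1,k_2)\in\{1,\dots,n\}^2$ with $k=(k_2-1)n+k_1$ (i.e. the standard basis vector $e_k$ is $\mathrm{vec}(e_{k_1}e_{k_2}^T)$, where vec stacks columns). For fixed $\tau,\rho,\beta>0$, $$\Phi(i,j)=\begin{cases}10\exp\left(-\dfrac{(|i-j|/\beta)^2}{5\rho\tau}\right), & \sqrt{4\rho\tau}\le\dfrac{|i-j|}{\beta}\le 2\rho\tau,\\[2ex] 10\,\dfrac{\exp(-\rho\tau)}{\rho\tau}\left(\dfrac{\mathrm{e}\,\rho\tau}{|i-j|/\beta}\right)^{|i-j|/\beta}, & \dfrac{|i-j|}{\beta}\ge 2\rho\tau.\end{cases}$$ (When both cases apply, the first is used.) *)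

(* Defs.v *)
From HB Require Import structures.
From mathcomp Require Import all_boot all_order all_algebra.
From mathcomp Require Import all_classical all_reals all_analysis.
From mathcomp Require Import mxtens.

Set Implicit Arguments.
Unset Strict Implicit.
Unset Printing Implicit Defensive.

Import Order.TTheory GRing.Theory Num.Theory.
Import numFieldNormedType.Exports.

Local Open Scope ring_scope.
Local Open Scope classical_set_scope.
Local Open Scope sesquilinear_scope.

Definition expmx (C : numFieldType) (n : nat) (A : 'M[C]_n) : 'M[C]_n :=
  limn (series (fun k : nat => k`!%:R^-1 *: A ^+ k)).

Definition banded (C : numFieldType) (n beta : nat) (M : 'M[C]_n) : Prop :=
  forall i j : 'I_n, (beta < `|i - j|)%N -> M i j = 0.

(* In a [numClosedFieldType], [0 <= z] says that [z] is real and nonnegative. *)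
Definition hermitian_psd (C : numClosedFieldType) (n : nat) (M : 'M[C]_n) : Prop :=
  M \is hermsymmx /\ forall x : 'cV[C]_n, 0 <= (x ^t* *m M *m x) 0 0.

(* [mxtens_index] puts its first component in the most significant position,
   whereas [k1] is the least significant part of [k = k2 * n + k1]. *)
Definition lex (n : nat) (k1 k2 : 'I_n) : 'I_(n * n) := mxtens_index (k2, k1).

Fact val_lex (n : nat) (k1 k2 : 'I_n) : val (lex k1 k2) = (k2 * n + k1)%N.
Proof. by []. Qed.

(* The value 0 outside the two ranges is a junk value. *)
Definition Phi (R : realType) (tau rho : R) (beta i j : nat) : R :=
  let s : R := `|i - j|%N%:R / beta%:R in
  if (Num.sqrt (4 * rho * tau) <= s) && (s <= 2 * rho * tau) then
    10 * expR (- (s ^+ 2 / (5 * rho * tau)))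
  else if 2 * rho * tau <= s then
    10 * (expR (- (rho * tau)) / (rho * tau)) *
      (expR 1 * (rho * tau) / s) `^ s
  else 0.

(* Main.v *)
Require Import Defs.
From mathcomp Require Import all_boot all_order all_algebra.
From mathcomp Require Import all_classical all_reals all_analysis.
From mathcomp Require Import complex mxtens.
From mathcomp Require Import ring lra.

Import Order.TTheory GRing.Theory Num.Theory.
Import numFieldNormedType.Exports.

Local Open Scope ring_scope.
Local Open Scope complex_scope.

(** Write [M = P^* D P] with [P] unitary; all exponentials involved are then
    computed on the diagonal, and [I (x) M + M (x) I] is diagonalized by [P (x) P]
    with eigenvalues [x_a + x_b], which gives the factorization.

    For the decay, put [z = rho tau], [Y = I - M / (2 rho)], whose spectrum lies
    in [[-1, 1]], and [s = |i - j| / beta].  The Chebyshev matrices [T_k(Y)] have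
    entries bounded by 1, and their [(i, j)] entry vanishes for [k < s].  The
    recurrence [Y T_k = (T_(k+1) + T_(k-1)) / 2] then yields, for every [q >= 1],
    [|(Y^m)_ij| <= 2 q^-s ((q + 1/q) / 2)^m] (a Chernoff bound for the simple
    random walk).  Since [exp(-tau M) = exp(-2z) exp(2z Y)], summing the
    exponential series gives
    [|exp(-tau M)_ij| <= 2 exp(-2z) q^-s exp(z (q + 1/q))].
    The two branches of [Phi] come from [q = (2 + u) / (2 - u)] with
    [u = 2 s / (5 z)], and from [q = s / z]. *)

(** * Limits of matrix entries and complex numbers, and partial sums of the exponential series *)

Lemma cvg_mx_coord {K : numFieldType} {m n : nat} (u : nat -> 'M[K]_(m, n))
    (L : 'M[K]_(m, n)) :
  (forall i j, ((fun k => u k i j) @ \oo --> L i j)%classic) ->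
  (u @ \oo --> L)%classic.
Proof.
move=> uL A [P PL sPA].
have : (\forall k \near \oo, forall i j, P i j (u k i j))%classic.
  by apply: filter_forall => i; apply: filter_forall => j; exact: uL.
by apply: filterS => k Pu; exact: sPA.
Qed.

Lemma cvg_real_complex {R : realType} (u : nat -> R) (l : R) :
  (u @ \oo --> l)%classic ->
  ((fun k => (u k)%:C : (R[i] : numFieldType)) @ \oo -->
   (l%:C : (R[i] : numFieldType)))%classic.
Proof.
move=> ul; apply/cvgrPdist_lt => e e0.
(* The order on [R[i]] is partial and a positive element is real, so the complex tolerance [e] comes
   from one in [R]. *)
have eE : e = (complex.Re e)%:C by rewrite RRe_real// gtr0_real.
rewrite eE ltcR in e0; rewrite eE.
have /cvgrPdist_lt/(_ _ e0) := ul; apply: filterS => k.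
rewrite -raddfB/= normc_def/= expr0n/= addr0 sqrtr_sqr.
by rewrite ltcR.
Qed.

Lemma cvg_complex_norm_le {R : realType} (u : nat -> (R[i] : numFieldType))
    (l : (R[i] : numFieldType)) (B : R) :
  (u @ \oo --> l)%classic -> (forall k, `|u k| <= B%:C) -> `|l| <= B%:C.
Proof.
move=> ul uB.
have lE : `|l| = (complex.Re `|l|)%:C by rewrite RRe_real// normr_real.
rewrite lE lecR; apply/ler_addgt0Pr => e e0.
have eC0 : 0 < e%:C :> R[i] by rewrite ltcR.
have /cvgrPdist_le/(_ _ eC0) [N _ /(_ N (leqnn N)) h] := ul.
rewrite -lecR -lE raddfD/= -(subrK (u N) l) addrC.
by apply: le_trans (ler_normD _ _) _; rewrite lerD.
Qed.

Lemma expR_seriesE {R : realType} (x : R) (N : nat) :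
  series (exp_coeff x) N = \sum_(k < N) x ^+ k / k`!%:R.
Proof. by rewrite seriesEord. Qed.

Lemma cvg_exp_series {R : realType} (x : R) :
  ((fun N => \sum_(k < N) x ^+ k / k`!%:R) @ \oo --> expR x)%classic.
Proof.
by apply: cvg_trans (is_cvg_series_exp_coeff x); rewrite seriesEord.
Qed.

Lemma exp_series_le_expR {R : realType} (x : R) (N : nat) :
  0 <= x -> \sum_(k < N) x ^+ k / k`!%:R <= expR x.
Proof.
move=> x0; rewrite -expR_seriesE; apply: nondecreasing_cvgn_le.
  by apply: nondecreasing_series => k _ _; rewrite /exp_coeff/= divr_ge0// exprn_ge0.
exact: is_cvg_series_exp_coeff.
Qed.

(** * Functional calculus for matrices with a known real diagonalization *)

Section DiagonalizedExp.
Context {R : realType} {n : nat} (P Q : 'M[R[i]]_n) (PQ : P *m Q = 1%:M).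

Let diag (f : 'I_n -> R) : 'M[R[i]]_n := diag_mx (\row_l (f l)%:C).

Lemma eq_conj_diag (f g : 'I_n -> R) :
  f =1 g -> Q *m diag f *m P = Q *m diag g *m P.
Proof. by move=> /funext ->. Qed.

Lemma conj_diagE (f : 'I_n -> R) (i j : 'I_n) :
  (Q *m diag f *m P) i j = \sum_l Q i l * (f l)%:C * P l j.
Proof.
rewrite mul_mx_diag mxE; apply: eq_bigr => l _.
by rewrite !mxE.
Qed.

Lemma conj_diagM (f g : 'I_n -> R) :
  (Q *m diag f *m P) *m (Q *m diag g *m P) = Q *m diag (fun l => f l * g l) *m P.
Proof.
rewrite !mulmxA -(mulmxA _ P Q) PQ mulmx1 -(mulmxA Q) mulmx_diag.
congr (_ *m diag_mx _ *m _); apply/rowP => l.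
by rewrite !mxE -rmorphM.
Qed.

Lemma conj_diagD (f g : 'I_n -> R) :
  Q *m diag f *m P + Q *m diag g *m P = Q *m diag (fun l => f l + g l) *m P.
Proof.
apply/matrixP => i j; rewrite mxE !conj_diagE -big_split/=; apply: eq_bigr => l _.
by rewrite raddfD/= mulrDr mulrDl.
Qed.

Lemma conj_diagZ (a : R) (f : 'I_n -> R) :
  a%:C *: (Q *m diag f *m P) = Q *m diag (fun l => a * f l) *m P.
Proof.
apply/matrixP => i j; rewrite mxE !conj_diagE mulr_sumr; apply: eq_bigr => l _.
by rewrite rmorphM/= !mulrA (mulrC a%:C).
Qed.

Lemma conj_diag1 : Q *m diag (fun=> 1) *m P = 1.
Proof.
apply: etrans (mulmx1C PQ); congr (_ *m _); rewrite -[RHS]mulmx1; congr (_ *m _).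
by apply/matrixP => i j; rewrite !mxE rmorph1.
Qed.

Lemma conj_diagX (f : 'I_n -> R) (k : nat) :
  (Q *m diag f *m P) ^+ k = Q *m diag (fun l => f l ^+ k) *m P.
Proof.
elim: k => [|k IH]; first by rewrite expr0 -conj_diag1.
rewrite exprS IH [LHS]conj_diagM; apply: eq_conj_diag => l.
by rewrite exprS.
Qed.

(** The limit can be taken entrywise: each entry of a partial sum is a fixed finite combination of
    scalar exponential partial sums at the [f l]. *)
Lemma expmx_conj_diag (f : 'I_n -> R) :
  expmx (Q *m diag f *m P) = Q *m diag (fun l => expR (f l)) *m P.
Proof.
apply: cvg_lim; first exact: norm_hausdorff.
apply: cvg_mx_coord => i j; rewrite conj_diagE.
have -> : (fun k => series (fun k : nat => k`!%:R^-1 *: (Q *m diag f *m P) ^+ k) k i j) =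
   fun N => \sum_l Q i l * (\sum_(k < N) f l ^+ k / k`!%:R)%:C * P l j.
  apply/funext => N; rewrite seriesEord summxE.
  under eq_bigr => k _.
    rewrite conj_diagX -(rmorph_nat (real_complex R)) -fmorphV conj_diagZ conj_diagE.
    over.
  rewrite exchange_big/=; apply: eq_bigr => l _.
  rewrite rmorph_sum/= mulr_sumr mulr_suml; apply: eq_bigr => k _.
  by rewrite (mulrC (f l ^+ k)).
apply: (@cvg_big (R[i] : numFieldType)); first exact: add_continuous.
move=> l _.
apply: cvgM; last exact: cvg_cst.
apply: cvgM; first exact: cvg_cst.
exact/cvg_real_complex/cvg_exp_series.
Qed.

End DiagonalizedExp.

(** * Real inequalities behind the two branches of [Phi] *)

Section ScalarBounds.
Context {R : realType}.

(* Compares the coefficients of [x ^ k] in [expR x] and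
   [(2 + x) / (2 - x) = 1 + 2 \sum_(k >= 1) (x / 2) ^ k]: [1 / k! <= 2 / 2 ^ k]. *)
Lemma expR_le_pade (x : R) : 0 <= x < 2 -> expR x <= (2 + x) / (2 - x).
Proof.
move=> /andP[x0 x2].
have h0 : 2 - x != 0 by lra.
(* The subtracted term is the tail [2 \sum_(k > N) (x / 2) ^ k] of the geometric series, which makes
   the induction on [N] go through. *)
suff ub N : \sum_(k < N.+1) x ^+ k / k`!%:R <=
    (2 + x) / (2 - x) - 2 * (x / 2) ^+ N * (x / (2 - x)).
  have t0 : 0 <= x / (2 - x) by rewrite divr_ge0// subr_ge0 ltW.
  have := @cvg_exp_series R x; move/cvg_lim => <- //.
  apply: limr_le; first by apply/cvg_ex; exists (expR x); exact: cvg_exp_series.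
  exists 1%N => // -[//|N] _.
  apply: le_trans (ub N) _; rewrite lerBlDr lerDl.
  by apply: mulr_ge0 => //; apply: mulr_ge0 => //; rewrite exprn_ge0// divr_ge0.
elim: N => [|N IH].
  rewrite big_ord1 !expr0 fact0 divr1 mulr1 le_eqVlt; apply/orP; left.
  by apply/eqP; field.
rewrite big_ord_recr/=.
have coef : x ^+ N.+1 / N.+1`!%:R <= 2 * (x / 2) ^+ N.+1.
  rewrite expr_div_n mulrCA ler_wpM2l ?exprn_ge0//.
  rewrite exprS invfM mulrA divff ?pnatr_eq0// mul1r.
  rewrite lef_pV2 ?posrE ?exprn_gt0 ?ltr0n ?fact_gt0//.
  rewrite -natrX ler_nat; elim: N {IH} => // N IHN.
  by rewrite expnS factS leq_mul.
apply: le_trans (lerD IH coef) _; rewrite le_eqVlt; apply/orP; left; apply/eqP.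
rewrite exprS; move: (_ ^+ N) => p; field; exact: h0.
Qed.

(** With [u = 2 s / (5 z)], [q] is the Padé approximant of [expR u]. Hence [q >= expR u] gives the
    decay [expR (- (u * s))], while [q + 1/q - 2] is rational and of order [u^2]. *)
Lemma decay_small (z s : R) : 0 < z -> 0 <= s <= 2 * z ->
  let q := (2 + 2 * s / (5 * z)) / (2 - 2 * s / (5 * z)) in
  1 <= q /\
  expR (- (2 * z)) * q `^ (- s) * expR (z * (q + q^-1)) <=
    expR (- (s ^+ 2 / (5 * z))).
Proof.
move=> z0 /andP[s0 s2]; set u := 2 * s / (5 * z).
have sE : s = 5 * z * u / 2 by rewrite /u; field; rewrite gt_eqF.
have u0 : 0 <= u by rewrite divr_ge0// mulr_ge0// ltW.
have u4 : u <= 4 / 5.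
  rewrite /u ler_pdivrMr ?mulr_gt0//; lra.
clearbody u.
have hm : 0 < 2 - u by lra.
have hp : 0 < 2 + u by lra.
move=> q; have qE : q + q^-1 - 2 = 4 * u ^+ 2 / (4 - u ^+ 2).
  rewrite /q; field; rewrite !gt_eqF//=.
  have -> : 4 - u ^+ 2 = (2 - u) * (2 + u) by ring.
  by rewrite mulr_gt0.
have uq : expR u <= q by apply: expR_le_pade; lra.
have q1 : 1 <= q by apply: le_trans uq; rewrite -expR0 ler_expR.
split=> //.
have qs : q `^ (- s) <= expR (- (u * s)).
  rewrite powRN expRN lef_pV2 ?posrE ?expR_gt0 ?powR_gt0//; last lra.
  by rewrite expRM ge0_ler_powR// nnegrE ?expR_ge0//; lra.
(* [84 / 25] is the value of [4 - u ^+ 2] at the largest admissible [u = 4 / 5]. *)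
have qz : z * (q + q^-1) <= 2 * z + z * (4 * u ^+ 2 / (84 / 25)).
  have -> : q + q^-1 = 2 + 4 * u ^+ 2 / (4 - u ^+ 2) by rewrite -qE; ring.
  rewrite mulrDr (mulrC z 2) lerD2l ler_pM2l// ler_wpM2l ?mulr_ge0 ?sqr_ge0//.
  by rewrite lef_pV2 ?posrE; nra.
apply: le_trans (_ : expR (- (2 * z)) * expR (- (u * s)) *
   expR (2 * z + z * (4 * u ^+ 2 / (84 / 25))) <= _).
  by rewrite ler_pM ?mulr_ge0 ?expR_ge0 ?powR_ge0 ?ler_expR// ler_wpM2l ?expR_ge0.
(* In units of [z * u ^+ 2] the exponent is at most [- 5/2 + 25/21 = - 55/42], below the required
   [- 5/4]. *)
rewrite -!expRD ler_expR sE.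
have -> : (5 * z * u / 2) ^+ 2 / (5 * z) = 5 / 4 * (z * u ^+ 2).
  by field; rewrite gt_eqF.
have : 0 <= z * u ^+ 2 by rewrite mulr_ge0 ?sqr_ge0 ?ltW.
by lra.
Qed.

(** The choice [q = s / z] minimizes [q^-s expR (z q)]. The remaining [z / q = z^2 / s] costs at
    most [z / 2] in the exponent, and [expR (- (z / 2)) <= 2 / z] produces the factor [1 / z]. *)
Lemma decay_large (z s : R) : 0 < z -> 2 * z <= s ->
  let q := s / z in
  1 <= q /\
  expR (- (2 * z)) * q `^ (- s) * expR (z * (q + q^-1)) <=
    2 * (expR (- z) / z) * (expR 1 * z / s) `^ s.
Proof.
move=> z0 s2 q; have s0 : 0 < s by lra.
have q0 : 0 < q by rewrite divr_gt0.
split; first by rewrite /q ler_pdivlMr//; lra.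
have -> : expR 1 * z / s = expR 1 * q^-1 by rewrite /q invf_div mulrA.
rewrite powRM ?expR_ge0 ?invr_ge0 ?(ltW q0)// -expRM mul1r.
have -> : q^-1 `^ s = q `^ (- s).
  by rewrite -powR_inv1 ?ltW// -powRrM mulN1r.
have -> : z * (q + q^-1) = s + z * (z / s).
  by rewrite /q; field; rewrite !gt_eqF.
have zs : z * (z / s) <= z / 2.
  by rewrite ler_pM2l// ler_pdivrMr//; lra.
have ez : expR (- (z / 2)) <= 2 / z.
  rewrite expRN -[2 / z]invf_div lef_pV2 ?posrE ?expR_gt0 ?divr_gt0//.
  by apply: le_trans (expR_ge1Dx _); rewrite lerDr.
have eE : expR (- (2 * z)) * expR (s + z * (z / s)) <=
    2 * (expR (- z) / z) * expR s.
  rewrite -expRD; apply: le_trans (_ : expR (- z + s + - (z / 2)) <= _).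
    by rewrite ler_expR; lra.
  rewrite expRD (_ : _ * expR s = expR (- z + s) * (2 / z)); last first.
    by rewrite expRD; ring.
  by rewrite ler_wpM2l ?expR_ge0.
by rewrite mulrAC [leRHS]mulrA ler_wpM2r ?powR_ge0.
Qed.

End ScalarBounds.

(** * Chebyshev polynomials and propagation of bandwidth *)

(** Stated over any ring, so that one recurrence serves both the matrix and its eigenvalues. *)
Fixpoint cheb {S : pzRingType} (x : S) (k : nat) : S :=
  match k with
  | 0 => 1
  | k1.+1 => match k1 with
             | 0 => x
             | k2.+1 => 2%:R * x * cheb x k1 - cheb x k2
             end
  end.

Lemma cheb_cos {R : realType} (a : R) (k : nat) : cheb (cos a) k = cos (k%:R * a).
Proof.
(* The recurrence has two steps, so the induction carries two consecutive indices. *)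
suff [] : cheb (cos a) k = cos (k%:R * a) /\
    cheb (cos a) k.+1 = cos (k.+1%:R * a) by [].
elim: k => [|k [IH0 IH1]]; first by rewrite mul0r mul1r cos0.
split=> //; rewrite [LHS]/= -/(cheb _ k.+1) IH1 IH0.
have -> : k.+2%:R * a = k.+1%:R * a + a by rewrite -[k.+2]addn1 natrD mulrDl mul1r.
have -> : k%:R * a = k.+1%:R * a - a by rewrite -[k.+1]addn1 natrD mulrDl mul1r addrK.
by rewrite cosB cosD; ring.
Qed.

Lemma cheb_norm_le1 {R : realType} (x : R) (k : nat) : -1 <= x <= 1 -> `|cheb x k| <= 1.
Proof. by move=> x1; rewrite -(acosK x1) cheb_cos cos_max. Qed.

Lemma banded_mono {C : numFieldType} {n b c : nat} (A : 'M[C]_n) :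
  (b <= c)%N -> banded b A -> banded c A.
Proof. by move=> bc hA i j ij; apply: hA; exact: leq_ltn_trans ij. Qed.

Lemma banded1 {C : numFieldType} {n : nat} : banded 0 (1 : 'M[C]_n).
Proof. by move=> i j; rewrite mxE; case: eqP => // -> ; rewrite subrr. Qed.

Lemma bandedD {C : numFieldType} {n b : nat} (A B : 'M[C]_n) :
  banded b A -> banded b B -> banded b (A + B).
Proof. by move=> hA hB i j ij; rewrite mxE hA// hB// addr0. Qed.

Lemma bandedN {C : numFieldType} {n b : nat} (A : 'M[C]_n) :
  banded b A -> banded b (- A).
Proof. by move=> hA i j ij; rewrite mxE hA// oppr0. Qed.

Lemma bandedZ {C : numFieldType} {n b : nat} (a : C) (A : 'M[C]_n) :
  banded b A -> banded b (a *: A).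
Proof. by move=> hA i j ij; rewrite mxE hA// mulr0. Qed.

Lemma bandedM {C : numFieldType} {n b c : nat} (A B : 'M[C]_n) :
  banded b A -> banded c B -> banded (b + c) (A * B).
Proof.
move=> hA hB i j ij; rewrite mxE big1// => l _.
have [il|il] := ltnP b `|i - l|%N; first by rewrite hA// mul0r.
rewrite hB ?mulr0//.
have := leq_trans ij (leqD_dist i l j).
by move=> h; rewrite -(ltn_add2l b); apply: leq_trans h _; rewrite leq_add2r.
Qed.

(** [T_k] has degree at most [k], and each multiplication by [A] widens the band by at most [b]. *)
Lemma banded_cheb {C : numFieldType} {n b : nat} (A : 'M[C]_n) (k : nat) :
  banded b A -> banded (k * b) (cheb A k).
Proof.
move=> hA; suff [] : banded (k * b) (cheb A k) /\ banded (k.+1 * b) (cheb A k.+1) by [].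
elim: k => [|k [IH0 IH1]]; first by rewrite mul0n mul1n; split=> //; exact: banded1.
split=> //; rewrite [cheb _ _]/= -/(cheb _ k.+1); apply: bandedD; last first.
  by apply: bandedN; apply: banded_mono IH0; rewrite leq_mul2r -addn2 leq_addr orbT.
rewrite mulSn -mulrA mulr_natl -scaler_nat; apply: bandedZ; exact: bandedM.
Qed.

(** * Entry bounds for a banded matrix with spectrum in [[-1, 1]] *)

Section BandedDecay.
Context {R : realType} {n beta : nat} (P Y : 'M[R[i]]_n) (y : 'I_n -> R)
  (PU : P \is unitarymx)
  (YE : Y = invmx P *m diag_mx (\row_l (y l)%:C) *m P)
  (y1 : forall l, -1 <= y l <= 1)
  (beta_gt0 : (0 < beta)%N) (Yband : banded beta Y).

Let PQ : P *m invmx P = 1%:M.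
Proof. by rewrite mulmxV// unitarymx_unit. Qed.

Lemma cheb_conj_diag (k : nat) :
  cheb Y k = invmx P *m diag_mx (\row_l (cheb (y l) k)%:C) *m P.
Proof.
suff [] : cheb Y k = invmx P *m diag_mx (\row_l (cheb (y l) k)%:C) *m P /\
  cheb Y k.+1 = invmx P *m diag_mx (\row_l (cheb (y l) k.+1)%:C) *m P by [].
elim: k => [|k [IH0 IH1]].
  by split; [rewrite (conj_diag1 P (invmx P) PQ)|exact: YE].
split; first exact: IH1.
rewrite [LHS]/= -/(cheb Y k.+1) IH1 IH0 {1}YE -mulrA.
rewrite [X in _ * X](conj_diagM P (invmx P) PQ) mulr_natl -scaler_nat.
rewrite -(rmorph_nat (real_complex R)) conj_diagZ.
rewrite -scaleN1r -(rmorphN1 (real_complex R)) conj_diagZ conj_diagD.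
apply: eq_conj_diag => l.
by rewrite /= mulrA mulN1r.
Qed.

(* AM-GM and the fact that the columns [i] and [j] of [P] are unit vectors. *)
Lemma norm_conj_diag_le1 (f : 'I_n -> R) (i j : 'I_n) :
  (forall l, `|f l| <= 1) ->
  `|(invmx P *m diag_mx (\row_l (f l)%:C) *m P) i j| <= 1.
Proof.
move=> f1; rewrite conj_diagE (invmx_unitary PU).
have col1 (c : 'I_n) : \sum_l `|P l c| ^+ 2 = 1.
  have := mulVmx (unitarymx_unit PU); rewrite (invmx_unitary PU).
  move=> /matrixP/(_ c c); rewrite !mxE eqxx mulr1n => <-.
  by apply: eq_bigr => l _; rewrite !mxE normCK mulrC.
apply: le_trans (ler_norm_sum _ _ _) _.
apply: le_trans (_ : \sum_l (`|P l i| ^+ 2 + `|P l j| ^+ 2) / 2 <= 1); last first.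
  by rewrite -mulr_suml big_split/= !col1 -mulr2n -[1 *+ 2]/(2%:R) divff ?pnatr_eq0.
apply: ler_sum => l _; rewrite !normrM !mxE norm_conjC.
have fl : `|(f l)%:C : R[i]| <= 1.
  by rewrite normc_def/= expr0n/= addr0 sqrtr_sqr -(rmorph1 (real_complex R)) lecR.
have ab : `|P l i| * `|P l j| <= (`|P l i| ^+ 2 + `|P l j| ^+ 2) / 2.
  rewrite ler_pdivlMr// mulr_natr -subr_ge0.
  have -> : `|P l i| ^+ 2 + `|P l j| ^+ 2 - `|P l i| * `|P l j| *+ 2 =
    (`|P l i| - `|P l j|) ^+ 2 by ring.
  by rewrite real_exprn_even_ge0// realB ?normr_real.
apply: le_trans ab; rewrite ler_wpM2r// ler_piMr//.
Qed.

Context (i j : 'I_n) (q : R) (q1 : 1 <= q).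
Let s : R := `|i - j|%N%:R / beta%:R.

Let q_gt0 : 0 < q. Proof. exact: lt_le_trans q1. Qed.

(** Either [k < s] and the entry lies outside the band, or [k >= s] and the bound 1 on the entry is
    at most [q^(k - s)], because [q >= 1]. *)
Lemma norm_cheb_le (k : nat) : `|cheb Y k i j| <= (q `^ (- s) * q ^+ k)%:C.
Proof.
have [ks|sk] := ltnP (k * beta) `|i - j|%N.
  by rewrite (banded_cheb _ k Yband)// normr0 lecR mulr_ge0 ?powR_ge0 ?exprn_ge0 ?ltW.
apply: le_trans (_ : 1%:C <= _).
  by rewrite cheb_conj_diag norm_conj_diag_le1// => l; exact: cheb_norm_le1.
rewrite lecR -powR_mulrn ?(ltW q_gt0)// -powRD; last by rewrite (gt_eqF q_gt0) implybT.
rewrite -[leLHS](powRr0 q) ler_powR// addrC subr_ge0 /s ler_pdivrMr ?ltr0n//.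
by rewrite -natrM ler_nat.
Qed.

(* [X * T_k = (T_(k+1) + T_(k-1)) / 2] turns into
   [(q + 1/q) / 2 * (q^k + q^-k) = (q^(k+1) + q^-(k+1) + q^(k-1) + q^-(k-1)) / 2]. *)
Lemma norm_expr_cheb_le (m k : nat) :
  `|(Y ^+ m * cheb Y k) i j| <=
  (q `^ (- s) * ((q + q^-1) / 2) ^+ m * (q ^+ k + q^-1 ^+ k))%:C.
Proof.
elim: m k => [|m IH] k.
  rewrite expr0 mul1r mulr1; apply: le_trans (norm_cheb_le k) _.
  rewrite lecR ler_wpM2l ?powR_ge0// lerDl exprn_ge0// invr_ge0 ltW//.
(* At [k = 0] the recurrence has no predecessor: [Y T_0 = T_1], and [q^0 + q^-0 = 2] cancels the
   denominator of [(q + 1/q) / 2]. *)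
rewrite exprSr -mulrA; case: k => [|k].
  rewrite mulr1; apply: le_trans (IH 1%N) _.
  rewrite lecR le_eqVlt; apply/orP; left; apply/eqP.
  by rewrite !expr1 !expr0 exprS; field; rewrite gt_eqF.
have -> : Y * cheb Y k.+1 = (2^-1)%:C *: (cheb Y k.+2 + cheb Y k).
  have -> : cheb Y k.+2 + cheb Y k = 2%:R%:C *: (Y * cheb Y k.+1).
    by rewrite [cheb Y k.+2]/= subrK -mulrA mulr_natl -scaler_nat rmorph_nat.
  by rewrite scalerA -rmorphM mulVf ?pnatr_eq0// rmorph1 scale1r.
rewrite -[_ * _]scalemxAr -[_ *m _]/(_ * _) mulrDr mxE normrM [X in _ * `|X|]mxE.
have -> : `|(2^-1)%:C : R[i]| = (2^-1)%:C by rewrite ger0_norm// ler0c.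
have {}IH := lerD (IH k.+2) (IH k).
apply: le_trans (ler_wpM2l _ (le_trans (ler_normD _ _) IH)) _; first by rewrite ler0c.
rewrite -rmorphD -rmorphM lecR le_eqVlt; apply/orP; left; apply/eqP.
by rewrite !exprS !exprVn; field; rewrite ?expf_neq0 ?gt_eqF.
Qed.

(** This is the case [T_0 = 1]; the factor 2 is [q^0 + q^-0]. *)
Lemma norm_expr_le (m : nat) :
  `|(Y ^+ m) i j| <= (2 * q `^ (- s) * ((q + q^-1) / 2) ^+ m)%:C.
Proof.
have := norm_expr_cheb_le m 0; rewrite mulr1 !expr0 => /le_trans; apply.
by rewrite lecR le_eqVlt; apply/orP; left; apply/eqP; ring.
Qed.

(** The power bound is summed against the coefficients of [exp(2 z Y)]; each partial sum is
    dominated by the series of [expR (2 z h)], where [2 z h = z (q + 1/q)]. *)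
Lemma norm_exp_le (z : R) : 0 <= z ->
  `|(invmx P *m diag_mx (\row_l (expR (2 * z * y l))%:C) *m P) i j| <=
  (2 * q `^ (- s) * expR (z * (q + q^-1)))%:C.
Proof.
move=> z0; rewrite conj_diagE; set h := (q + q^-1) / 2.
have h0 : 0 <= h by rewrite divr_ge0// addr_ge0 ?invr_ge0 ?(ltW q_gt0).
pose u N := \sum_(k < N) ((2 * z) ^+ k / k`!%:R)%:C * (Y ^+ k) i j.
apply: (@cvg_complex_norm_le _ u) => [|N]; last first.
  apply: le_trans (ler_norm_sum _ _ _) _.
  apply: le_trans (_ : (2 * q `^ (- s) *
      \sum_(k < N) (2 * z * h) ^+ k / k`!%:R)%:C <= _); last first.
    rewrite lecR ler_wpM2l ?mulr_ge0 ?powR_ge0//.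
    have -> : z * (q + q^-1) = 2 * z * h by rewrite /h; field; rewrite gt_eqF.
    by apply: exp_series_le_expR; rewrite mulr_ge0// mulr_ge0.
  rewrite mulr_sumr rmorph_sum/=; apply: ler_sum => k _; rewrite normrM.
  rewrite ger0_norm ?ler0c ?divr_ge0 ?exprn_ge0 ?mulr_ge0//.
  apply: le_trans (ler_wpM2l _ (norm_expr_le k)) _.
    by rewrite ler0c divr_ge0 ?exprn_ge0 ?mulr_ge0.
  rewrite -rmorphM lecR le_eqVlt; apply/orP; left; apply/eqP.
  by rewrite [in RHS]exprMn -/h; ring.
(* Rewriting the partial sums in terms of the eigenvalues identifies their limit. *)
have -> : u = fun N => \sum_l invmx P i l *
    (\sum_(k < N) (2 * z * y l) ^+ k / k`!%:R)%:C * P l j.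
  apply/funext => N; rewrite /u.
  transitivity (\sum_(k < N) \sum_l ((2 * z) ^+ k / k`!%:R)%:C *
      (invmx P i l * (y l ^+ k)%:C * P l j)).
    by apply: eq_bigr => k _; rewrite YE (conj_diagX P (invmx P) PQ) conj_diagE mulr_sumr.
  rewrite exchange_big/=; apply: eq_bigr => l _.
  rewrite rmorph_sum/= mulr_sumr mulr_suml; apply: eq_bigr => k _.
  have -> : (2 * z * y l) ^+ k / k`!%:R = (2 * z) ^+ k / k`!%:R * y l ^+ k.
    by rewrite exprMn mulrAC.
  by rewrite (rmorphM _ ((2 * z) ^+ k / k`!%:R))/= [in RHS]mulrCA -[in RHS]mulrA.
apply: (@cvg_big (R[i] : numFieldType)); first exact: add_continuous.
move=> l _; apply: cvgM; last exact: cvg_cst.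
apply: cvgM; first exact: cvg_cst.
exact/cvg_real_complex/cvg_exp_series.
Qed.

End BandedDecay.

(** * Spectral theorem and decay of the entries of [exp(-tau M)] *)

Lemma hermitian_diag {R : realType} {n : nat} (rho : R) (M : 'M[R[i]]_n) :
  M \is hermsymmx ->
  (forall a : R[i], eigenvalue M a -> 0 <= a <= (4 * rho)%:C) ->
  exists P : 'M[R[i]]_n, exists x : 'I_n -> R,
    [/\ P \is unitarymx, M = invmx P *m diag_mx (\row_l (x l)%:C) *m P &
        forall l, 0 <= x l <= 4 * rho].
Proof.
move=> Mherm hspec; set P := spectralmx M; set D := spectral_diag M.
have PU : P \is unitarymx by exact: spectral_unitarymx.
have ME : M = invmx P *m diag_mx D *m P.
  exact/orthomx_spectralP/hermitian_normalmx.
have eigD l : 0 <= D 0 l <= (4 * rho)%:C.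
  (* Eigenvectors are row vectors here: [P M = D P] makes row [l] of [P] one for [D 0 l], nonzero
     because [P] is invertible. *)
  apply: hspec; apply/eigenvalueP; exists (row l P).
    rewrite -row_mul ME !mulmxA mulmxV ?unitarymx_unit// mul1mx.
    by apply/rowP => c; rewrite mul_diag_mx !mxE.
  apply/eqP => /(congr1 (fun v => v *m invmx P)).
  rewrite -row_mul mulmxV ?unitarymx_unit// mul0mx => /rowP/(_ l).
  by rewrite !mxE eqxx => /eqP; rewrite oner_eq0.
have Dreal l : (complex.Re (D 0 l))%:C = D 0 l.
  by rewrite RRe_real// ger0_real//; case/andP: (eigD l).
pose x l := complex.Re (D 0 l).
have DE : \row_l (x l)%:C = D by apply/rowP => l; rewrite mxE Dreal.
exists P, x; split; first exact: PU.
- by rewrite DE; exact: ME.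
- by move=> l; have := eigD l; rewrite -Dreal ler0c lecR.
Qed.

Lemma expmx_banded_decay {R : realType} {n beta : nat} (rho tau : R) (M : 'M[R[i]]_n)
    (i j : 'I_n) (q : R) :
  (0 < beta)%N -> 0 < rho -> 0 < tau -> M \is hermsymmx -> banded beta M ->
  (forall a : R[i], eigenvalue M a -> 0 <= a <= (4 * rho)%:C) -> 1 <= q ->
  `|expmx (- tau%:C *: M) i j| <=
  (2 * (expR (- (2 * (rho * tau))) * q `^ (- (`|i - j|%N%:R / beta%:R)) *
        expR (rho * tau * (q + q^-1))))%:C.
Proof.
move=> beta0 rho0 tau0 Mherm Mband hspec q1.
set z := rho * tau; set s := `|i - j|%N%:R / beta%:R.
have [P [x [PU ME x4]]] := hermitian_diag rho M Mherm hspec.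
have PQ : P *m invmx P = 1%:M by rewrite mulmxV// unitarymx_unit.
(* This affine map sends [[0, 4 rho]] onto [[-1, 1]] and satisfies [- tau x = - 2 z + 2 z y]. *)
pose y l := 1 + - (2 * rho)^-1 * x l.
have y1 l : -1 <= y l <= 1.
  have /andP[x0 xr] := x4 l.
  have t0 : 0 <= (2 * rho)^-1 * x l by rewrite mulr_ge0// invr_ge0 mulr_ge0// ltW.
  have t2 : (2 * rho)^-1 * x l <= 2 by rewrite ler_pdivrMl ?mulr_gt0//; lra.
  by rewrite /y mulNr; apply/andP; split; lra.
pose Y := 1 + (- (2 * rho)^-1)%:C *: M.
have YE : Y = invmx P *m diag_mx (\row_l (y l)%:C) *m P.
  by rewrite /Y {1}ME conj_diagZ -(conj_diag1 P (invmx P) PQ) conj_diagD.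
have Yband : banded beta Y.
  apply: bandedD; last exact: bandedZ.
  by apply: banded_mono banded1.
have z0 : 0 <= z by rewrite mulr_ge0 ?ltW.
have := norm_exp_le P Y y PU YE y1 beta0 Yband i j q q1 z z0.
rewrite ME -rmorphN conj_diagZ (expmx_conj_diag P (invmx P) PQ).
have -> : invmx P *m diag_mx (\row_l (expR (- tau * x l))%:C) *m P =
    (expR (- (2 * z)))%:C *:
    (invmx P *m diag_mx (\row_l (expR (2 * z * y l))%:C) *m P).
  rewrite conj_diagZ; apply: eq_conj_diag => l.
  rewrite -expRD /y /z; congr expR; field.
  by rewrite gt_eqF.
move=> le1; rewrite mxE normrM ger0_norm ?ler0c ?expR_ge0//.
apply: le_trans (ler_wpM2l _ le1) _; first by rewrite ler0c expR_ge0.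
rewrite -rmorphM lecR le_eqVlt; apply/orP; left; apply/eqP; rewrite -/s; ring.
Qed.

(** The cases meet at [s = 2 rho tau], and the lower bound on [s] keeps [Phi] off its junk value.
    The constant 10 absorbs a factor 2 in the first branch and [2 * 2] in the second. *)
Lemma expmx_entry_le_Phi {R : realType} {n beta : nat} (rho tau : R) (M : 'M[R[i]]_n)
    (i j : 'I_n) :
  (0 < beta)%N -> 0 < rho -> 0 < tau -> M \is hermsymmx -> banded beta M ->
  (forall a : R[i], eigenvalue M a -> 0 <= a <= (4 * rho)%:C) ->
  Num.sqrt (4 * rho * tau) * beta%:R <= `|i - j|%N%:R ->
  `|expmx (- tau%:C *: M) i j| <= (Phi tau rho beta i j)%:C.
Proof.
move=> beta0 rho0 tau0 Mherm Mband hspec.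
have b0 : 0 < beta%:R :> R by rewrite ltr0n.
rewrite -ler_pdivlMr//; set s := _ / _ => s_ge.
have z0 : 0 < rho * tau by rewrite mulr_gt0.
rewrite /Phi -/s s_ge/= -(mulrA 2 rho tau).
have [s_le|s_gt] := leP s (2 * (rho * tau)).
  have s0 : 0 <= s by rewrite divr_ge0.
  have [q1 decay] := decay_small (rho * tau) s z0 ltac:(by rewrite s0).
  apply: le_trans (expmx_banded_decay rho tau M i j _ beta0 rho0 tau0 Mherm Mband hspec q1) _.
  rewrite lecR; apply: ler_pM => //.
  - by rewrite !mulr_ge0 ?expR_ge0 ?powR_ge0.
  - by rewrite ler_nat.
  - by rewrite -(mulrA 5).
rewrite (ltW s_gt).
have [q1 decay] := decay_large (rho * tau) s z0 (ltW s_gt).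
apply: le_trans (expmx_banded_decay rho tau M i j _ beta0 rho0 tau0 Mherm Mband hspec q1) _.
rewrite lecR; apply: le_trans (_ : 2 * (2 * (expR (- (rho * tau)) / (rho * tau)) *
   (expR 1 * (rho * tau) / s) `^ s) <= _); first by rewrite ler_wpM2l.
rewrite !(mulrA 2) ler_wpM2r ?powR_ge0// ler_wpM2r ?divr_ge0 ?expR_ge0 ?(ltW z0)//.
by rewrite -natrM ler_nat.
Qed.

(** * The exponential of the Kronecker sum *)

Lemma expmx_kronecker_sum {R : realType} {n : nat} (rho tau : R) (M : 'M[R[i]]_n) :
  M \is hermsymmx ->
  (forall a : R[i], eigenvalue M a -> 0 <= a <= (4 * rho)%:C) ->
  expmx (- tau%:C *: (tensmx 1%:M M + tensmx M 1%:M)) =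
  tensmx (expmx (- tau%:C *: M)) (expmx (- tau%:C *: M)).
Proof.
move=> Mherm hspec; have [P [x [PU ME _]]] := hermitian_diag rho M Mherm hspec.
have PQ : P *m invmx P = 1%:M by rewrite mulmxV// unitarymx_unit.
have PPQQ : tensmx P P *m tensmx (invmx P) (invmx P) = 1%:M.
  rewrite tensmx_mul PQ; apply/matrixP => a b.
  case: (mxtens_indexP a) => a1 a2; case: (mxtens_indexP b) => b1 b2.
  by rewrite tensmxE !mxE (can_eq (@mxtens_indexK _ _)) xpair_eqE -natrM mulnb.
have tens_diag (f g : 'I_n -> R) :
    tensmx (invmx P *m diag_mx (\row_l (f l)%:C) *m P)
           (invmx P *m diag_mx (\row_l (g l)%:C) *m P) =
    tensmx (invmx P) (invmx P) *m
      diag_mx (\row_l (f (mxtens_unindex l).1 * g (mxtens_unindex l).2)%:C) *m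
      tensmx P P.
  rewrite -!tensmx_mul.
  suff -> : tensmx (diag_mx (\row_l (f l)%:C)) (diag_mx (\row_l (g l)%:C)) =
      diag_mx (\row_l (f (mxtens_unindex l).1 * g (mxtens_unindex l).2)%:C) by [].
  apply/matrixP => a b.
  case: (mxtens_indexP a) => a1 a2; case: (mxtens_indexP b) => b1 b2.
  rewrite tensmxE !mxE mxtens_indexK (can_eq (@mxtens_indexK _ _)) xpair_eqE.
  by rewrite rmorphM/=; do 2![case: eqP => _]; rewrite ?mulr1n ?mulr0n ?mulr0 ?mul0r.
(* The identity is written in the eigenbasis of [M], so that [tens_diag] puts both Kronecker terms
   in the common basis [tensmx P P]. *)
have E1 : 1%:M = invmx P *m diag_mx (\row_l (1 : R)%:C) *m P.
  by rewrite (conj_diag1 P (invmx P) PQ).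
rewrite -rmorphN {1 2}ME {1 2}E1 !tens_diag conj_diagD conj_diagZ.
rewrite (expmx_conj_diag _ _ PPQQ).
rewrite ME conj_diagZ (expmx_conj_diag P (invmx P) PQ) tens_diag.
apply: eq_conj_diag => l.
by rewrite -expRD mul1r mulr1 mulrDr addrC.
Qed.

Theorem theorem6p1 (R : realType) (n beta : nat) (rho : R) (M : 'M[R[i]]_n)
  (hbeta : (1 <= beta)%N) (hrho : 0 < rho)
  (hpsd : hermitian_psd M) (hband : banded beta M)
  (hspec : forall a : R[i], eigenvalue M a -> 0 <= a <= (4 * rho)%:C) :
  let A : 'M[R[i]]_(n * n) := tensmx 1%:M M + tensmx M 1%:M in
  (forall (tau : R) (k1 k2 t1 t2 : 'I_n),
     expmx (- tau%:C *: A) (lex k1 k2) (lex t1 t2) =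
     expmx (- tau%:C *: M) k1 t1 * expmx (- tau%:C *: M) k2 t2) /\
  (forall (tau : R), 0 < tau -> forall k1 k2 t1 t2 : 'I_n,
     Num.sqrt (4 * rho * tau) * beta%:R <=
       Num.min `|t1 - k1|%N%:R `|t2 - k2|%N%:R ->
     `|expmx (- tau%:C *: A) (lex k1 k2) (lex t1 t2)| <=
       (Phi tau rho beta k1 t1 * Phi tau rho beta k2 t2)%:C).
Proof.
move=> A.
have tens (tau : R) (k1 k2 t1 t2 : 'I_n) :
    expmx (- tau%:C *: A) (lex k1 k2) (lex t1 t2) =
    expmx (- tau%:C *: M) k1 t1 * expmx (- tau%:C *: M) k2 t2.
  (* [lex] pairs the indices as [(k2, k1)], so the factors come out in reverse order and [mulrC]
     swaps them. *)
  by rewrite (expmx_kronecker_sum rho tau M hpsd.1 hspec) /lex tensmxE mulrC.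
split=> // tau tau0 k1 k2 t1 t2; rewrite le_min => /andP[h1 h2].
rewrite tens normrM rmorphM; apply: ler_pM => //.
  apply: (expmx_entry_le_Phi rho tau M k1 t1 hbeta hrho tau0 hpsd.1 hband hspec).
  by rewrite distnC.
apply: (expmx_entry_le_Phi rho tau M k2 t2 hbeta hrho tau0 hpsd.1 hband hspec).
by rewrite distnC.
Qed.
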